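(* Let $d \ge 1$ and let $\mathbf{S}_1, \ldots, \mathbf{S}_{d+1} \subset \mathbb{R}^d$ be pairwise disjoint sets with $|\mathbf{S}_i| = d+1$ for each $i$. Let $p \in \mathbb{R}^d$ be a point with $p \notin \bigcup_i \mathbf{S}_i$, such that the points of $\bigcup_{i=1}^{d+1}\mathbf{S}_i \cup \{p\}$ are in general position and $p \in \operatorname{int}(\operatorname{conv}(\mathbf{S}_i))$ for every $i = 1, \ldots, d+1$. Then the number of colourful simplices containing $p$ is at least $\left\lceil \frac{(d+1)^2}{2} \right\rceil$. Equivalently, $\mu(d) \ge \left\lceil \frac{(d+1)^2}{2}\right\rceil$.
   Context: A colourful simplex is the closed simplex $\operatorname{conv}\{x_1, \ldots, x_{d+1}\}$ with $x_i \in \mathbf{S}_i$ for each $i$ (one vertex from each set $\mathbf{S}_i$); distinct choices of $(x_1,\dots,x_{d+1})$ count as distinct simplices. The quantity $\mu(d)$ denotes the minimum, over all such configurations (sets $\mathbf{S}_1,\dots,\mathbf{S}_{d+1}$ of $d+1$ points each and a point $p$ in general position with $p$ in the interior of each $\operatorname{conv}(\mathbf{S}_i)$), of the number of colourful simplices containing $p$. *)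

(* Defs.v *)
(* Points of R^d are row vectors 'rV[R]_d over an arbitrary
   real field R (the statement is order-theoretic / semi-algebraic). *)
From HB Require Import structures.
From mathcomp Require Import all_boot all_order all_algebra.
Set Implicit Arguments. Unset Strict Implicit. Unset Printing Implicit Defensive.
Import Order.TTheory GRing.Theory Num.Theory.
Local Open Scope ring_scope.

Definition in_conv (R : realFieldType) (d : nat) (I : finType)
    (f : I -> 'rV[R]_d) (x : 'rV[R]_d) : Prop :=
  exists lam : I -> R,
    (forall i, 0 <= lam i) /\ \sum_i lam i = 1 /\ \sum_i lam i *: f i = x.

Definition in_int_conv (R : realFieldType) (d : nat) (I : finType)
    (f : I -> 'rV[R]_d) (x : 'rV[R]_d) : Prop :=
  exists2 eps : R, 0 < eps &
    forall q : 'rV[R]_d, (forall k, `|q 0 k - x 0 k| < eps) -> in_conv f q.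

Definition aff_indep (R : realFieldType) (d : nat) (I : finType)
    (f : I -> 'rV[R]_d) (A : {set I}) : Prop :=
  forall lam : I -> R,
    \sum_(a in A) lam a *: f a = 0 -> \sum_(a in A) lam a = 0 ->
    forall a, a \in A -> lam a = 0.

Definition gen_pos (R : realFieldType) (d : nat) (I : finType)
    (f : I -> 'rV[R]_d) : Prop :=
  injective f /\ forall A : {set I}, (#|A| <= d.+1)%N -> aff_indep f A.

(* All points: Some (i, j) = j-th point of colour class S_i, None = p. *)
Definition all_pts (R : realFieldType) (d : nat)
    (S : 'I_d.+1 -> 'I_d.+1 -> 'rV[R]_d) (p : 'rV[R]_d)
    (o : option ('I_d.+1 * 'I_d.+1)) : 'rV[R]_d :=
  match o with Some ij => S ij.1 ij.2 | None => p end.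

Definition colourful_contains (R : realFieldType) (d : nat)
    (S : 'I_d.+1 -> 'I_d.+1 -> 'rV[R]_d) (p : 'rV[R]_d)
    (c : {ffun 'I_d.+1 -> 'I_d.+1}) : Prop :=
  in_conv (fun i => S i (c i)) p.

(* Main.v *)
Require Import Defs.
From HB Require Import structures.
From mathcomp Require Import all_boot all_order all_algebra.
From mathcomp Require Import boolp.
From mathcomp Require Import zify ring lra.
Set Implicit Arguments. Unset Strict Implicit. Unset Printing Implicit Defensive.

(** Let [n = d + 1] and let [E] be the set of colourful simplices containing [p].  Among [d + 2]
    points in general position, the number of points whose removal leaves a simplex containing [p]
    is 0 or 2, so "contains [p]" is a mod 2 cocycle; hence [E] meets every octahedron (two points
    of each colour) in an even number of simplices.  By the colourful Caratheodory theorem every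
    point lies on some member of [E].

    The bound is then combinatorial.  If two points of the same colour have different links in [E],
    their degrees add up to at least [n].  So either some colour class has total degree at least
    [n^2 / 2], or in every class [i] more than half of the points form a set [D_i] with a common
    link of size less than [n / 2].  In the latter case no member of [E] meets two of the [D_i],
    since replacing one of its vertices inside [D_j] would give too many simplices through a point
    of [D_i]; as every point of each [D_i] is covered, [E] has at least [sum_i |D_i| > n^2 / 2]
    members. *)

(** * Octahedral systems *)

Section OctahedralSystems.
Variables I V : finType.
Implicit Types (a b c : {ffun I -> V}) (E : {set {ffun I -> V}}) (s : {set I}).

Definition upd c i x : {ffun I -> V} := [ffun j => if j == i then x else c j].

Definition mix a b s : {ffun I -> V} := [ffun j => if j \in s then b j else a j].

(** The [mix a b s] are the facets of the octahedron with vertices [a j], [b j]; the [addb] sum is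
    the parity of the number of them in [E]. *)
Definition octahedral E :=
  forall a b, (forall j, a j != b j) ->
  \big[addb/false]_(s : {set I}) (mix a b s \in E) = false.

Definition deg E i x := #|[set c in E | c i == x]|.

(** Equality of the links of [x] and [y] in class [i]: [c] is a full choice, but its value at [i] is
    overwritten. *)
Definition twin E i x y := [forall c, (upd c i x \in E) == (upd c i y \in E)].

Lemma big_addb_pairs (i : I) (F : {set I} -> bool) :
  \big[addb/false]_(s : {set I}) F s =
  \big[addb/false]_(s : {set I} | i \notin s) (F s (+) F (i |: s)).
Proof.
rewrite big_split /= (bigID (fun s : {set I} => i \notin s)) /=; congr addb.
rewrite (reindex_onto (fun s : {set I} => i |: s) (fun s => s :\ i)) /=; last first.
  by move=> s; rewrite negbK => /setD1K.
apply: eq_bigl => s; rewrite setU11 /=.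
apply/eqP/idP => [<-|/setU1K //]; by rewrite !inE eqxx.
Qed.

Lemma upd_same c i : upd c i (c i) = c.
Proof. by apply/ffunP => j; rewrite ffunE; case: eqP => [->|]. Qed.

Lemma deg_sum E i : \sum_x deg E i x = #|E|.
Proof.
rewrite -[RHS]sum1_card (partition_big (fun c => c i) predT) //=.
by apply: eq_bigr => x _; rewrite /deg -sum1_card; apply: eq_bigl => c; rewrite inE.
Qed.

Lemma twin_deg E i x y : twin E i x y -> deg E i x = deg E i y.
Proof.
have le u v : twin E i u v -> deg E i u <= deg E i v; last first.
  move=> t; apply/eqP; rewrite eqn_leq le // le //.
  by apply/forallP => c; rewrite eq_sym; exact: (forallP t c).
move=> t; rewrite /deg -(@card_in_imset _ _ (fun c => upd c i v)) => [|c c'].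
  apply/subset_leq_card/subsetP => _ /imsetP[c + ->]; rewrite inE => /andP[cE /eqP ci].
  by rewrite inE ffunE !eqxx andbT -(eqP (forallP t c)) -ci upd_same.
rewrite !inE => /andP[_ /eqP ci] /andP[_ /eqP ci'] /ffunP e; apply/ffunP => j.
by have := e j; rewrite !ffunE; case: (j =P i) => // -> _; rewrite ci ci'.
Qed.

(* The symmetric difference of the slices at [x] and [y] is again octahedral; if every other class
   had an isolated vertex for it, an octahedron through those vertices would contain exactly one
   of its edges. *)
Lemma nontwin_deg E i x y :
  octahedral E -> ~~ twin E i x y -> #|V| <= deg E i x + deg E i y.
Proof.
move=> octE /forallPn[c0 gc0].
pose g c := (upd c i x \in E) (+) (upd c i y \in E).
have {}gc0 : g c0 by rewrite /g; move: gc0; do 2 case: (_ \in E).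
have xy : x != y.
  by apply/eqP => e; move: gc0; rewrite /g e addbb.
have [/existsP[j /andP[ji /forallP full]] | /existsPn none] :=
  boolP [exists j, (j != i) && [forall v, exists c, g c && (c j == v)]].
  (* No vertex of class [j] is isolated, and the members chosen through the various [v] are distinct
     since they differ at [j]. *)
  have /fin_all_exists[h hP] v : exists c, [/\ c \in E, (c i == x) || (c i == y) & c j = v].
    have /existsP[c /andP[gc /eqP cj]] := full v.
    have [cx|cx] := boolP (upd c i x \in E).
      by exists (upd c i x); rewrite !ffunE eqxx (negbTE ji) eqxx.
    exists (upd c i y); rewrite !ffunE eqxx (negbTE ji) eqxx orbT; split => //.
    by move: gc; rewrite /g (negbTE cx).
  have h_inj : injective h.
    by move=> v w e; have [_ _ <-] := hP v; have [_ _ <-] := hP w; rewrite e.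
  rewrite -cardsT -(card_imset _ h_inj) (leq_trans _ (leq_card_setU _ _)) //.
  apply/subset_leq_card/subsetP => _ /imsetP[v _ ->].
  by have [hE hi _] := hP v; rewrite !inE hE.
have /fin_all_exists[y' y'P] j : exists v, j != i -> forall c, c j = v -> g c = false.
  have := none j; case: (j =P i) => [->|_] /=; first by exists x.
  case/forallPn=> v /existsPn nv; exists v => _ c cj; apply/negbTE.
  by have := nv c; rewrite cj eqxx andbT.
(* Away from [i], [b] consists of isolated vertices, so only the pair indexed by [set0] contributes
   to the parity, and it contributes [g c0]. *)
pose a := upd c0 i x; pose b := [ffun j => if j == i then y else y' j].
have ab j : a j != b j.
  rewrite !ffunE; case: (eqVneq j i) => [_|ji] //.
  by apply/eqP => e; have := y'P j ji _ e; rewrite gc0.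
have := octE a b ab; rewrite (big_addb_pairs i) (bigD1 set0) ?inE //= big1 => [|s /andP[si s0]].
  have -> : mix a b set0 = upd c0 i x by apply/ffunP => j; rewrite !ffunE inE.
  have -> : mix a b (i |: set0) = upd c0 i y.
    by apply/ffunP => j; rewrite !ffunE !inE orbF; case: eqP.
  by rewrite addbF -/(g c0) gc0.
have /set0Pn[j js] := s0.
have ji : j != i by apply: contraNneq si => <-.
rewrite -[RHS](y'P j ji (mix a b s)) ?ffunE ?js ?(negbTE ji) // /g.
congr ((_ \in E) (+) (_ \in E)); apply/ffunP => k; rewrite !ffunE ?inE.
  by case: (k =P i) => [->|//]; rewrite (negbTE si).
by case: (k =P i).
Qed.

Lemma octahedral_card E :
  #|V| <= #|I| -> octahedral E -> (forall i x, exists2 c, c \in E & c i = x) ->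
  #|V| ^ 2 <= 2 * #|E|.
Proof.
move=> VI octE iso; set m := #|V|.
have [//|small] := leqP (m ^ 2) (2 * #|E|).
pose D i x := [set y | twin E i x y].
have /fin_all_exists[x xP] i : exists x, 2 * deg E i x < m /\ m < 2 * #|D i x|.
  have [/existsP[x kx]|/existsPn big] := boolP [exists x, 2 * deg E i x < m]; last first.
    move: small; rewrite -(deg_sum E i) big_distrr /= ltnNge => /negP[].
    by rewrite -mulnn -sum_nat_const; apply: leq_sum => v _; rewrite leqNgt big.
  exists x; split=> //; rewrite ltnNge; apply/negP => Dm.
  move: small; rewrite -(deg_sum E i) (bigID (mem (D i x))) /=.
  have e1 : \sum_(y in D i x) deg E i y = #|D i x| * deg E i x.
    rewrite -sum_nat_const; apply: eq_bigr => y; rewrite inE => t.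
    by rewrite (twin_deg t).
  have e2 : (m - #|D i x|) * (m - deg E i x) <= \sum_(y | y \notin D i x) deg E i y.
    have -> : m - #|D i x| = #|~: D i x| by rewrite /m -(cardsC (D i x)) addKn.
    rewrite -sum_nat_const (eq_bigl (fun y => y \notin D i x)) => [|y]; last by rewrite inE.
    apply: leq_sum => y; rewrite inE => /(nontwin_deg octE); rewrite -/m; lia.
  rewrite e1 ltnNge => /negP[].
  have Dle : #|D i x| <= m := max_card _.
  move: e2; move: (\sum_(_ | _) _) => r.
  move: #|D i x| (deg E i x) Dm Dle kx => D0 k Dm Dle kx e2.
  (* Twice [D0 * k + (m - D0) * (m - k)] exceeds [m ^ 2] by [(m - 2 * D0) * (m - 2 * k)], a product
     of nonnegative factors. *)
  nia.
have xT i j y : i != j -> y \in D j (x j) -> forall c, c \in E -> c i \in D i (x i) -> c j != y.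
  move=> ij yD c cE ci; apply/eqP => cj.
  have cE' : upd c i (x i) \in E.
    by move: ci; rewrite inE => /forallP/(_ c)/eqP ->; rewrite upd_same.
  (* Once [c] is moved through [x i], its vertex [y] may be swapped for any element of [D j (x j)],
     which gives more than [m / 2] members through [x i]. *)
  have : #|D j (x j)| <= deg E i (x i).
    pose h z := upd (upd c i (x i)) j z.
    have h_inj : injective h by move=> z w /ffunP/(_ j); rewrite !ffunE eqxx.
    rewrite -(card_imset _ h_inj); apply/subset_leq_card/subsetP => _ /imsetP[z zD ->].
    rewrite inE !ffunE (negbTE ij) !eqxx andbT /h.
    move: zD yD; rewrite !inE => /forallP/(_ (upd c i (x i)))/eqP <-.
    move=> /forallP/(_ (upd c i (x i)))/eqP ->.
    have -> // : upd (upd c i (x i)) j y = upd c i (x i).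
    by rewrite -[RHS](upd_same _ j) !ffunE eq_sym (negbTE ij) cj.
  by have [+ _] := xP i; have [_ +] := xP j; lia.
have le_deg i : #|D i (x i)| <= \sum_(c in E) (c i \in D i (x i)).
  rewrite -big_mkcondr /= sum1_card.
  apply: leq_trans (leq_imset_card (fun c : {ffun I -> V} => c i) _).
  apply/subset_leq_card/subsetP => y yD; have [c cE ci] := iso i y.
  by apply/imsetP; exists c; rewrite // unfold_in /= cE ci.
have le_E : \sum_i #|D i (x i)| <= #|E|.
  apply: (@leq_trans (\sum_i \sum_(c in E) (c i \in D i (x i)))); first exact: leq_sum.
  rewrite exchange_big /= -sum1_card; apply: leq_sum => c cE.
  have [/existsP[i ci]|/existsPn nc] := boolP [exists i, c i \in D i (x i)].
    rewrite (bigD1 i) //= ci big1 // => j ji; apply/eqP; rewrite eqb0.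
    by apply/negP => cj; have := xT i j (c j); rewrite eq_sym => /(_ ji cj c cE ci)/eqP.
  by rewrite big1 // => i _; rewrite (negbTE (nc i)).
have : #|I| * m <= 2 * \sum_i #|D i (x i)|.
  rewrite big_distrr -sum_nat_const /=; apply: leq_sum => i _.
  by have [_ /ltnW] := xP i.
by move: VI; rewrite -/m; nia.
Qed.
End OctahedralSystems.

(** * Mod 2 cocycles evaluated on transversals *)

Section Cocycles.
Variables I V : finType.
Implicit Types (a b c : {ffun I -> V}) (s : {set I}).

Definition verts c : {set I * V} := [set (j, c j) | j : I].

Lemma mem_verts c j v : ((j, v) \in verts c) = (v == c j).
Proof.
by apply/imsetP/eqP => [[k _ [-> ->]]|->]; last exists j.
Qed.

Lemma card_verts c : #|verts c| = #|I|.
Proof. by rewrite card_imset // => j k []. Qed.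

(* On the full simplex a mod 2 cocycle [f] is the coboundary of its cone over any vertex, and an
   octahedral sphere has no boundary. *)
Lemma cocycle_octahedral (i : I) (f : {set I * V} -> bool) :
  (forall F : {set I * V}, #|F| = #|I|.+1 -> \big[addb/false]_(x in F) f (F :\ x) = false) ->
  octahedral [set c | f (verts c)].
Proof.
move=> fP a b ab; rewrite (big_addb_pairs i).
pose u := (i, b i).
pose h j s := f ((u |: verts (mix a b s)) :\ (j, mix a b s j)).
(* Cocycle condition on the cone from [u] over [mix a b s]: removing [u] or the vertex of colour [i]
   gives the two terms on the left, removing colour [j] gives [h j s]. *)
transitivity (\big[addb/false]_(s : {set I} | i \notin s) \big[addb/false]_(j | j != i) h j s).
  apply: eq_bigr => s si; rewrite !inE.
  have uN : u \notin verts (mix a b s).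
    by rewrite mem_verts ffunE (negbTE si) eq_sym ab.
  have := fP (u |: verts (mix a b s)); rewrite cardsU1 uN card_verts => /(_ erefl).
  rewrite big_setU1 //= setU1K // [X in _ (+) X]big_imset /=; last by move=> j k _ _ [].
  rewrite (bigD1 i) //= -[\big[addb/false]_(_ | _) _]/(\big[addb/false]_(j | j != i) h j s).
  have -> : (u |: verts (mix a b s)) :\ (i, mix a b s i) = verts (mix a b (i |: s)).
    apply/setP => -[j v]; rewrite !inE !mem_verts !ffunE (negbTE si) !inE !xpair_eqE.
    case: (eqVneq j i) => [->|//] /=; rewrite (negbTE si).
    by case: (eqVneq v (a i)) => [->|_] /=; rewrite ?orbF // (negbTE (ab i)).
  by move/eqP; rewrite addbA => /eqP; case: (f _); case: (f _); case: (\big[_/_]_(_ | _) _).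
rewrite exchange_big big1 // => j ji.
(* With the vertex of colour [j] deleted, the terms for [s] and [j |: s] coincide and cancel. *)
rewrite big_mkcond (big_addb_pairs j) big1 // => s js.
rewrite !inE eq_sym (negbTE ji) /=; case: (i \in s) => //=.
rewrite -[RHS](addbb (h j s)); congr addb; congr f.
apply/setP => -[k v]; rewrite !inE !mem_verts !ffunE !inE !xpair_eqE.
case: (eqVneq k j) => [->|//]; rewrite /= ?(negbTE js) (negbTE ji) /=.
by rewrite eqxx !andNb.
Qed.
End Cocycles.

Import Order.TTheory GRing.Theory Num.Theory.
Local Open Scope ring_scope.

(** * Colourful Caratheodory and pivoting *)

Section DotProduct.
Variables (R : realFieldType) (d : nat).
Implicit Types u w : 'rV[R]_d.

Definition dot u w : R := \sum_k u 0 k * w 0 k.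

Lemma dotC u w : dot u w = dot w u.
Proof. by apply: eq_bigr => k _; rewrite mulrC. Qed.

Lemma dotDl u1 u2 w : dot (u1 + u2) w = dot u1 w + dot u2 w.
Proof. by rewrite -big_split; apply: eq_bigr => k _; rewrite mxE mulrDl. Qed.

Lemma dotZl t u w : dot (t *: u) w = t * dot u w.
Proof. by rewrite mulr_sumr; apply: eq_bigr => k _; rewrite mxE mulrA. Qed.

Lemma dotBl u1 u2 w : dot (u1 - u2) w = dot u1 w - dot u2 w.
Proof. by rewrite -scaleN1r dotDl dotZl mulN1r. Qed.

Lemma dotDr u w1 w2 : dot u (w1 + w2) = dot u w1 + dot u w2.
Proof. by rewrite dotC dotDl !(dotC u). Qed.

Lemma dotZr t u w : dot u (t *: w) = t * dot u w.
Proof. by rewrite dotC dotZl dotC. Qed.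

Lemma dotBr u w1 w2 : dot u (w1 - w2) = dot u w1 - dot u w2.
Proof. by rewrite dotC dotBl !(dotC u). Qed.

Lemma dot0r u : dot u 0 = 0.
Proof. by rewrite -(scale0r 0) dotZr mul0r. Qed.

Lemma dot_sumr (I : finType) (P : pred I) u (F : I -> 'rV[R]_d) :
  dot u (\sum_(i | P i) F i) = \sum_(i | P i) dot u (F i).
Proof.
apply: (big_morph (dot u)) => [x y|]; first exact: dotDr.
exact: dot0r.
Qed.

Lemma dot_ge0 u : 0 <= dot u u.
Proof. by apply: sumr_ge0 => k _; rewrite -expr2 sqr_ge0. Qed.

Lemma dot_eq0 u : (dot u u == 0) = (u == 0).
Proof.
apply/eqP/eqP => [|->]; last exact: dot0r.
move/eqP; rewrite psumr_eq0 => [/allP u0|k _]; last by rewrite -expr2 sqr_ge0.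
apply/rowP => k; rewrite mxE; apply/eqP.
by rewrite -sqrf_eq0 expr2; apply: u0; rewrite mem_index_enum.
Qed.
End DotProduct.

(** * Linear dependences and orthogonal projection *)

Section Configurations.
Variables (R : realFieldType) (d : nat) (I : finType) (v : I -> 'rV[R]_d).
Implicit Types (A B F G H : {set I}) (lam e : I -> R).

Definition comb A lam : 'rV[R]_d := \sum_(x in A) lam x *: v x.

Definition indep A := forall lam, comb A lam = 0 -> forall x, x \in A -> lam x = 0.

(** Strict positivity puts the origin in the relative interior of the hull of a nonempty [A]. *)
Definition pos_dep A := exists2 lam, (forall x, x \in A -> 0 < lam x) & comb A lam = 0.

Lemma comb_D1 A lam x : x \in A -> comb A lam = lam x *: v x + comb (A :\ x) lam.
Proof. exact: big_setD1. Qed.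

Lemma comb_lin A lam e t : comb A (fun x => lam x + t * e x) = comb A lam + t *: comb A e.
Proof.
rewrite /comb scaler_sumr -big_split; apply: eq_bigr => x _.
by rewrite /= scalerDl scalerA.
Qed.

Lemma eq_comb A lam e : {in A, lam =1 e} -> comb A lam = comb A e.
Proof. by move=> h; apply: eq_bigr => x /h ->. Qed.

(** A Gram-Schmidt step: project both [a] and a new vector [v g] off the remaining ones, then remove
    from [a] its component along the residue of [v g]. *)
Lemma orthogonal_projection A (a : 'rV[R]_d) :
  exists e, forall x, x \in A -> dot (a - comb A e) (v x) = 0.
Proof.
move cA : #|A| => n; elim: n A cA a => [|n IH] A cA a.
  by exists (fun=> 0) => x; rewrite (cards0_eq cA) inE.
have /card_gt0P[g gA] : (0 < #|A|)%N by rewrite cA.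
have cA' : #|A :\ g| = n by move: cA; rewrite (cardsD1 g) gA => -[].
have [ea eaP] := IH _ cA' a; have [eg egP] := IH _ cA' (v g).
set ra := a - _ in eaP; set g' := v g - _ in egP.
(* If [g'] is zero, the quotient is zero by convention and there is nothing to remove. *)
pose r := dot ra g' / dot g' g'.
exists (fun x => if x == g then r else ea x + (- r) * eg x) => x xA.
have -> : a - comb A (fun x => if x == g then r else ea x + (- r) * eg x) = ra - r *: g'.
  rewrite (comb_D1 _ gA) eqxx (@eq_comb (A :\ g) _ (fun x => ea x + (- r) * eg x)).
    by rewrite comb_lin /ra /g'; apply/rowP => k; rewrite !mxE; ring.
  by move=> y; rewrite !inE => /andP[/negbTE ->].
have orthA' y : y \in A :\ g -> dot (ra - r *: g') (v y) = 0.
  by move=> yA; rewrite dotBl dotZl eaP // egP // mulr0 subr0.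
have [->|xg] := eqVneq x g; last by apply: orthA'; rewrite !inE xg.
have -> : v g = g' + comb (A :\ g) eg by rewrite subrK.
rewrite dotDr dot_sumr big1 => [|y yA]; last by rewrite dotZr orthA' ?mulr0.
rewrite addr0 dotBl dotZl /r.
have [g'0|g'0] := eqVneq (dot g' g') 0; last by rewrite divfK ?subrr.
by move/eqP: (g'0); rewrite dot_eq0 => /eqP ->; rewrite !dot0r mulr0 subr0.
Qed.

Lemma indep_orthogonal0 A (r : 'rV[R]_d) :
  #|A| = d -> indep A -> (forall x, x \in A -> dot r (v x) = 0) -> r = 0.
Proof.
move=> cA indA orth; pose M : 'M_(#|A|, d) := \matrix_(k < #|A|) v (enum_val k).
have freeM : row_free M.
  apply: inj_row_free => u uM.
  pose lam x := \sum_(k < #|A| | enum_val k == x) u 0 k.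
  have lamE k : lam (enum_val k) = u 0 k.
    by rewrite /lam (big_pred1 k) // => l /=; rewrite (inj_eq enum_val_inj).
  apply/rowP => k; rewrite mxE -lamE; apply: indA (enum_valP k).
  rewrite /comb big_enum_val -[RHS]uM mulmx_sum_row; apply: eq_bigr => l _.
  by rewrite lamE rowK.
have /row_fullP[N NM] : row_full M by rewrite /row_full (eqP freeM) cA.
apply: trmx_inj; rewrite trmx0 -[LHS]mul1mx -NM -mulmxA.
have -> : M *m r^T = 0; last by rewrite mulmx0.
apply/matrixP => k l; rewrite !mxE ord1 -[RHS](orth _ (enum_valP k)) dotC.
by apply: eq_bigr => i _; rewrite !mxE.
Qed.

Lemma indep_span A (a : 'rV[R]_d) : #|A| = d -> indep A -> exists e, a = comb A e.
Proof.
move=> cA indA; have [e eP] := orthogonal_projection A a.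
by exists e; apply: subr0_eq; apply: indep_orthogonal0 eP.
Qed.

(** * Descent towards the nearest point of a cone *)

Section Descent.
Variables (a : 'rV[R]_d) (e : {set I} -> I -> R).
Hypothesis eP : forall H x, x \in H -> dot (a - comb H (e H)) (v x) = 0.

Definition dist2 (y : 'rV[R]_d) := dot (a - y) (a - y).

Lemma projection_orthogonal H lam : dot (a - comb H (e H)) (comb H lam) = 0.
Proof. by rewrite dot_sumr big1 // => x xH; rewrite dotZr eP ?mulr0. Qed.

(* Pythagoras: moving from a point of the span of [G] towards the projection of [a] can only
   decrease the distance to [a]. *)
Lemma dist2_segment G c t :
  let z := comb G (e G) in let y := comb G c in
  dist2 (y + t *: (z - y)) = dist2 z + (1 - t) ^+ 2 * dot (z - y) (z - y).
Proof.
move=> z y; rewrite /dist2.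
have -> : a - (y + t *: (z - y)) = (a - z) + (1 - t) *: (z - y).
  by apply/rowP => k; rewrite !mxE; ring.
have o : dot (a - z) (z - y) = 0 by rewrite dotBr !projection_orthogonal subrr.
move: (a - z) (z - y) o => p q o.
by rewrite !(dotDl, dotDr, dotZl, dotZr) (dotC q p) o; ring.
Qed.

(** If the projection onto the span of [G] has a negative coefficient, walk towards it until a first
    coefficient vanishes and drop that vector; the distance does not grow. *)
Lemma cone_descent G c : (forall x, x \in G -> 0 <= c x) ->
  exists H, [/\ H \subset G, forall x, x \in H -> 0 <= e H x
    & dist2 (comb H (e H)) <= dist2 (comb G c)].
Proof.
move cG : #|G| => n; elim: n G cG c => [|n IH] G cG c c0.
  exists G; rewrite (cards0_eq cG); split=> // [x|]; first by rewrite inE.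
  by rewrite /comb !big_set0.
have [/forall_inP e0|/forall_inPn[x1 x1G ex1]] := boolP [forall x in G, 0 <= e G x].
  exists G; split=> //; have /= := dist2_segment G c 0; rewrite scale0r addr0 => ->.
  by rewrite lerDl mulr_ge0 ?sqr_ge0 ?dot_ge0.
have P1 : (x1 \in G) && (e G x1 < 0) by rewrite x1G ltNge.
(* The quotient is the time at which the coefficient of [h] reaches zero on the way from [c] to
   [e G]. *)
case: (@arg_minP _ R _ x1 [pred h in G | e G h < 0] (fun h => c h / (c h - e G h)) P1) => h0 /andP[h0G eh0] h0min.
set t := c h0 / _ in h0min.
have t0 : 0 <= t by rewrite divr_ge0 ?c0 // subr_ge0 (le_trans (ltW eh0)) ?c0.
have t1 : t <= 1.
  by rewrite ler_pdivrMr ?mul1r ?lerDl ?oppr_ge0 ?ltW // subr_gt0 (lt_le_trans eh0) ?c0.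
pose c' x := c x + t * (e G x - c x).
have c'h0 : c' h0 = 0.
  rewrite /c' /t; have := c0 _ h0G; set y := c h0; set w := e G h0 in eh0 *; move=> y0.
  by field; apply/eqP; lra.
have c'0 x : x \in G -> 0 <= c' x.
  move=> xG; have cx := c0 _ xG; rewrite /c'.
  have [ex|ex] := leP 0 (e G x); first by nra.
  have := h0min x; rewrite /= xG ex => /(_ isT).
  by rewrite ler_pdivlMr; [nra | lra].
have [] := IH (G :\ h0) _ c'.
- by move: cG; rewrite (cardsD1 h0) h0G => -[].
- by move=> x; rewrite inE => /andP[_]; exact: c'0.
move=> H [HG eH dH]; exists H; split=> //; first exact: subset_trans HG (subsetDl _ _).
apply: le_trans dH _.
have -> : comb (G :\ h0) c' = comb G c'.
  by rewrite (comb_D1 c' h0G) c'h0 scale0r add0r.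
have -> : comb G c' = comb G c + t *: (comb G (e G) - comb G c).
  rewrite comb_lin -[- comb G c]scaleN1r -(comb_lin G (e G)); congr (_ + t *: _).
  by apply: eq_comb => x _; rewrite mulN1r.
rewrite dist2_segment -[X in _ <= dist2 X]addr0 -(scale0r (comb G (e G) - comb G c)) dist2_segment.
by rewrite lerD2l ler_wpM2r ?dot_ge0 // subr0 expr1n expr_le1 //; lra.
Qed.
End Descent.

(** * Colourful Caratheodory theorem for cones *)

Section Caratheodory.
Variables (K : finType) (col : I -> K) (J : {set K}).
Hypothesis cardJ : #|J| = d.
Hypothesis gp : forall A, (#|A| <= d)%N -> indep A.

Definition transversal_in H := (col @: H \subset J) && (#|col @: H| == #|H|).

Lemma transversal_in_sub G H : H \subset G -> transversal_in G -> transversal_in H.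
Proof.
move=> HG /andP[GJ /imset_injP inj]; apply/andP; split.
  exact: subset_trans (imsetS _ HG) GJ.
by apply/imset_injP => x y /(subsetP HG) xG /(subsetP HG) yG; apply: inj.
Qed.

(* The partial transversal whose cone is closest to [a] must contain [a]: otherwise it misses some
   colour [j], and since [a] is in the cone of that colour class one of its points improves. *)
Lemma colourful_cone (a : 'rV[R]_d) :
  (forall j, j \in J -> exists2 c, (forall x, 0 <= c x) & a = comb [set x | col x == j] c) ->
  exists H, transversal_in H /\ exists2 e, (forall x, x \in H -> 0 <= e x) & a = comb H e.
Proof.
move=> aJ; have /fin_all_exists[e eP] := fun H => orthogonal_projection H a.
pose valid H := transversal_in H && [forall x in H, 0 <= e H x].
have valid0 : valid set0.
  rewrite /valid /transversal_in imset0 sub0set !cards0 eqxx /=.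
  by apply/forall_inP => x; rewrite inE.
case: (@arg_minP _ R _ set0 valid (fun H => dist2 a (comb H (e H))) valid0) =>
  H /andP[tH /forall_inP eH] Hmin.
exists H; split=> //; exists (e H) => //.
set z := comb H (e H); pose w := a - z.
apply/eqP; rewrite -subr_eq0 -/w; apply/negPn/negP => w0.
have [HJ|/subsetPn[j jJ jH]] := boolP (J \subset col @: H).
  case/andP: (tH) => HJ' /eqP cH; move/eqP: w0; apply; apply: (@indep_orthogonal0 H).
  - by rewrite -cH -cardJ; apply/eqP; rewrite eqn_leq !subset_leq_card.
  - by apply: gp; rewrite -cH -cardJ subset_leq_card.
  - exact: eP.
have wz : dot w z = 0 by exact: projection_orthogonal.
have ww : 0 < dot w w by rewrite lt_neqAle eq_sym dot_eq0 w0 dot_ge0.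
have wa : dot w a = dot w w by rewrite {3}/w dotBr wz subr0.
have [c c0 ac] := aJ _ jJ.
have [s sj ws] : exists2 s, col s = j & 0 < dot w (v s).
  apply: contrapT => no; move: ww; rewrite -wa ac dot_sumr ltNge => /negP[].
  apply: sumr_le0 => s; rewrite inE => /eqP sj; rewrite dotZr mulr_ge0_le0 //.
  by rewrite leNgt; apply/negP => ws; apply: no; exists s.
have sH : s \notin H by apply: contra jH => sH; rewrite -sj imset_f.
have tG : transversal_in (s |: H).
  case/andP: tH => HJ' /eqP cH; rewrite /transversal_in imsetU1 subUset sub1set sj jJ HJ'.
  by rewrite !cardsU1 sH jH cH /=.
have vs : 0 < dot (v s) (v s).
  rewrite lt_neqAle dot_ge0 andbT eq_sym dot_eq0; apply: contraTneq ws => ->.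
  by rewrite dot0r ltxx.
(* This multiple of [v s] minimises the distance to [a] along the ray from [z], and strictly
   improves on [z]. *)
pose eps := dot w (v s) / dot (v s) (v s).
pose c' x := if x == s then eps else e H x.
have [|G [GsH eG]] := @cone_descent a e eP (s |: H) c'.
  move=> x; rewrite /c' !inE; case: eqP => [_ _|_ /= xH]; last exact: eH.
  by rewrite divr_ge0 // ltW.
apply/negP; rewrite -ltNge; apply: lt_le_trans (Hmin G _); last first.
  by rewrite /valid (transversal_in_sub GsH tG); apply/forall_inP.
have -> : comb (s |: H) c' = z + eps *: v s.
  rewrite (@comb_D1 _ _ s) ?setU11 // setU1K // /c' eqxx addrC; congr (_ + _).
  by apply: eq_comb => x xH; case: eqP => // xs; rewrite -xs xH in sH.
rewrite /dist2 opprD addrA -/w.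
clearbody w; rewrite !(dotBl, dotBr, dotZl, dotZr) (dotC (v s) w).
have -> : eps * dot (v s) (v s) = dot w (v s) by rewrite divfK ?gt_eqF.
have : 0 < eps * dot w (v s) by rewrite mulr_gt0 // divr_gt0.
lra.
Qed.
End Caratheodory.

(** * Pivoting among [d + 2] vectors *)

Section Pivoting.
Hypothesis gp : forall A, (#|A| <= d)%N -> indep A.

Lemma comb0_two_zeros F lam x y : #|F| = d.+2 -> x \in F -> y \in F -> x != y ->
  comb F lam = 0 -> lam x = 0 -> lam y = 0 -> forall u, u \in F -> lam u = 0.
Proof.
move=> cF xF yF xy; have yF' : y \in F :\ x by rewrite !inE eq_sym xy.
rewrite (comb_D1 _ xF) (comb_D1 _ yF') => + x0 y0 u uF.
rewrite x0 y0 !scale0r !add0r => /gp h.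
have [->//|ux] := eqVneq u x; have [->//|uy] := eqVneq u y.
apply: h; last by rewrite !inE ux uy.
by move: cF; rewrite (cardsD1 x) xF (cardsD1 y) yF' !add1n => -[->].
Qed.

(** A vanishing coefficient would leave a dependence among [d] independent vectors, forcing
    [lam x = 0]. *)
Lemma nonneg_pos_dep B lam x : #|B| = d.+1 -> x \in B -> lam x != 0 ->
  (forall y, y \in B -> 0 <= lam y) -> comb B lam = 0 -> pos_dep B.
Proof.
move=> cB xB x0 nn B0; exists lam => // y yB; rewrite lt_neqAle nn // andbT eq_sym.
apply: contraNneq x0 => y0; have [->|xy] := eqVneq x y; first by rewrite y0.
move: B0; rewrite (comb_D1 _ yB) y0 scale0r add0r => /gp -> //; last by rewrite !inE xy.
by move: cB; rewrite (cardsD1 y) yB add1n => -[->].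
Qed.

Lemma pos_dep_D1 F x : x \in F -> pos_dep (F :\ x) ->
  exists lam, [/\ lam x = 0, forall y, y \in F -> y != x -> 0 < lam y & comb F lam = 0].
Proof.
move=> xF [lam lam0 c0]; exists (fun y => if y == x then 0 else lam y); rewrite eqxx.
split=> // [y yF yx|]; first by rewrite (negbTE yx) lam0 // !inE yx.
rewrite (comb_D1 _ xF) eqxx scale0r add0r -[RHS]c0; apply: eq_comb => y.
by rewrite !inE => /andP[/negbTE ->].
Qed.

(** The ratio test of the simplex method: to a dependence with coefficient 1 at [x], add the least
    multiple of the positive one on [F :\ x] that makes all coefficients nonnegative; the one at [y]
    vanishes. *)
Lemma pivot_exists F x : #|F| = d.+2 -> x \in F -> pos_dep (F :\ x) ->
  exists y, [/\ y \in F, y != x & pos_dep (F :\ y)].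
Proof.
move=> cF xF /(pos_dep_D1 xF)[lam [lamx lam0 c0]].
have cFx : #|F :\ x| = d.+1 by move: cF; rewrite (cardsD1 x) xF => -[].
have /card_gt0P[x' x'F] : (0 < #|F :\ x|)%N by rewrite cFx.
have cA : #|F :\ x :\ x'| = d by move: cFx; rewrite (cardsD1 x') x'F => -[].
have [|c vx] := indep_span (v x) cA; first by apply: gp; rewrite cA.
pose mu y := if y == x then 1 else if y == x' then 0 else 0 + (-1) * c y.
have mu0 : comb F mu = 0.
  have x'x : (x' == x) = false by move: x'F; rewrite !inE => /andP[/negbTE].
  rewrite (comb_D1 _ xF) (comb_D1 _ x'F) /mu eqxx x'x eqxx scale0r add0r scale1r.
  rewrite (@eq_comb _ _ (fun y => 0 + (-1) * c y)); last first.
    by move=> y; rewrite !inE => /and3P[/negbTE -> /negbTE ->].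
  rewrite comb_lin scaleN1r -vx addrCA subrr addr0 /comb big1 // => y _.
  by rewrite scale0r.
case: (@arg_maxP _ R _ x' (mem (F :\ x)) (fun y => - mu y / lam y) x'F) => y /setD1P[yx yF] ymax.
set t := - mu y / lam y in ymax.
pose nu u := mu u + t * lam u.
have nu0 : comb F nu = 0 by rewrite comb_lin mu0 c0 scaler0 addr0.
have nuy : nu y = 0.
  by rewrite /nu /t divfK ?subrr ?addrN // gt_eqF // lam0.
have nux : nu x = 1 by rewrite /nu lamx mulr0 addr0 /mu eqxx.
exists y; split=> //; apply: (@nonneg_pos_dep _ nu x).
- by move: cF; rewrite (cardsD1 y) yF => -[].
- by rewrite !inE eq_sym yx.
- by rewrite nux oner_eq0.
- move=> u; rewrite !inE => /andP[uy uF].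
  have [->|ux] := eqVneq u x; first by rewrite nux ler01.
  have /ymax : u \in F :\ x by rewrite !inE ux.
  rewrite /= ler_pdivrMr ?lam0 //.
  by rewrite /nu; lra.
- by move: nu0; rewrite (comb_D1 _ yF) nuy scale0r add0r.
Qed.

Lemma pivot_unique F x y y' : #|F| = d.+2 -> x \in F -> y \in F -> y' \in F ->
  y != x -> y' != x ->
  pos_dep (F :\ x) -> pos_dep (F :\ y) -> pos_dep (F :\ y') -> y = y'.
Proof.
move=> cF xF yF y'F yx y'x /(pos_dep_D1 xF)[lam [lamx lam0 lamF]].
move=> /(pos_dep_D1 yF)[nu [nuy nu0 nuF]] /(pos_dep_D1 y'F)[nu' [nuy' nu'0 nuF']].
apply/eqP/negPn/negP => yy'.
have nux : 0 < nu x by rewrite nu0 // eq_sym.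
have nux' : 0 < nu' x by rewrite nu'0 // eq_sym.
have ly : 0 < lam y by rewrite lam0.
have ly' : 0 < lam y' by rewrite lam0.
have n'y : 0 < nu' y by rewrite nu'0.
have ny' : 0 < nu y' by rewrite nu0 // eq_sym.
(* [r] cancels the coefficient of [om] at [x] and [s] the one at [y], while the one at [y'] stays
   positive. *)
pose r := nu x / nu' x; pose s := r * nu' y / lam y.
pose om u := nu u + (- r) * nu' u + s * lam u.
have omF : comb F om = 0 by rewrite !comb_lin nuF nuF' lamF !scaler0 !addr0.
have := comb0_two_zeros cF xF yF _ omF _ _ y'F; rewrite eq_sym yx /om => h.
have r0 : 0 < r by rewrite divr_gt0.
have s0 : 0 < s by rewrite divr_gt0 // mulr_gt0.
have : nu y' + - r * nu' y' + s * lam y' = 0.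
  apply: h => //; first by rewrite lamx /r; field; rewrite gt_eqF.
  by rewrite nuy /s; field; rewrite gt_eqF.
by rewrite nuy' mulr0 addr0; apply/eqP; rewrite gt_eqF // addr_gt0 // mulr_gt0.
Qed.

Lemma pos_dep_cocycle F : #|F| = d.+2 ->
  \big[addb/false]_(x in F) `[< pos_dep (F :\ x) >] = false.
Proof.
move=> cF; have [[x xF fx]|no] := pselect (exists2 x, x \in F & pos_dep (F :\ x)); last first.
  by rewrite big1 // => x xF; apply/asboolPn => fx; apply: no; exists x.
have [y [yF yx fy]] := pivot_exists cF xF fx.
rewrite (bigD1 x) //= (bigD1 y) ?yF //= big1 => [|u /andP[/andP[uF ux] uy]].
  by rewrite !asboolT.
apply/asboolPn => fu; move/eqP: uy; apply.
exact: pivot_unique fx fu fy.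
Qed.
End Pivoting.
End Configurations.

(** * Vectors centred at [p] and the colourful count *)

Lemma int_conv_cone (R : realFieldType) (d : nat) (I : finType) (f : I -> 'rV[R]_d) (p a : 'rV[R]_d) :
  in_int_conv f p ->
  exists2 c : I -> R, (forall i, 0 <= c i) & a = \sum_i c i *: (f i - p).
Proof.
(* [m] bounds every coordinate of [a], so [p + t *: a] stays in the [eps] box and hence in the hull;
   rescaling by [t^-1] recovers [a]. *)
move=> [eps eps0 h]; pose m := 1 + \sum_k `|a 0 k|; pose t := eps / (2 * m).
have m0 : 1 <= m by rewrite lerDl sumr_ge0.
have t0 : 0 < t by rewrite divr_gt0 // mulr_gt0 // (lt_le_trans ltr01).
have [k|lam [lam0 [lam1 lamq]]] := h (p + t *: a).
  have -> : (p + t *: a) 0 k - p 0 k = t * a 0 k by rewrite !mxE; ring.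
  rewrite normrM gtr0_norm // /t mulrAC ltr_pdivrMr; last by lra.
  have ak : `|a 0 k| <= m.
    by rewrite /m (bigD1 k) //= addrCA lerDl addr_ge0 // sumr_ge0.
  by rewrite ltr_pM2l //; lra.
exists (fun i => t^-1 * lam i) => [i|]; first by rewrite mulr_ge0 // invr_ge0 ltW.
transitivity (t^-1 *: \sum_i lam i *: (f i - p)); last first.
  by rewrite scaler_sumr; apply: eq_bigr => i _; rewrite scalerA.
have -> : \sum_i lam i *: (f i - p) = t *: a.
  rewrite (eq_bigr (fun i => lam i *: f i - lam i *: p)) => [|i _]; last exact: scalerBr.
  by rewrite sumrB lamq -scaler_suml lam1 scale1r addrC addKr.
by rewrite scalerA mulVf ?scale1r // gt_eqF.
Qed.

Section ColourfulDepth.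
Variables (R : realFieldType) (d : nat) (S : 'I_d.+1 -> 'I_d.+1 -> 'rV[R]_d) (p : 'rV[R]_d).

Definition centred (x : 'I_d.+1 * 'I_d.+1) : 'rV[R]_d := S x.1 x.2 - p.

Lemma gen_pos_indep (A : {set 'I_d.+1 * 'I_d.+1}) :
  gen_pos (all_pts S p) -> (#|A| <= d)%N -> indep centred A.
Proof.
move=> [_ gp] cA lam lamA x xA.
have NA : None \notin Some @: A by apply/imsetP => -[].
have injS : {in A &, injective (@Some ('I_d.+1 * 'I_d.+1))} by move=> ? ? _ _ [].
(* The coefficient of [p] balances the others, turning a linear dependence of centred vectors into
   an affine one. *)
pose lam' o := if o is Some y then lam y else - \sum_(y in A) lam y.
apply: (gp (None |: Some @: A) _ lam' _ _ (Some x)).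
- by rewrite cardsU1 NA card_imset //; move=> ? ? [].
- rewrite big_setU1 // big_imset //= -[RHS]lamA /comb /centred.
  under [RHS]eq_bigr do rewrite scalerBr.
  by rewrite sumrB -scaler_suml scaleNr addrC.
- by rewrite big_setU1 // big_imset //= addNr.
- by rewrite inE imset_f ?orbT.
Qed.

Lemma pos_dep_colourful_contains (c : {ffun 'I_d.+1 -> 'I_d.+1}) :
  pos_dep centred (verts c) -> colourful_contains S p c.
Proof.
move=> [lam lam0].
have inj_verts : {in 'I_d.+1 &, injective (fun j => (j, c j))} by move=> ? ? _ _ [].
have lamj j : 0 < lam (j, c j) by rewrite lam0 ?mem_verts.
rewrite /comb big_imset //=; under eq_bigr do rewrite scalerBr; rewrite sumrB -scaler_suml.
set s := \sum_i lam _ => /subr0_eq e.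
have s0 : 0 < s.
  by rewrite /s big_ord_recl ltr_pwDl // sumr_ge0 // => j _; rewrite ltW.
exists (fun j => s^-1 * lam (j, c j)); split; [|split].
- by move=> j; apply: mulr_ge0; rewrite ?invr_ge0 ltW.
- by rewrite -mulr_sumr mulVf // gt_eqF.
- under eq_bigr do rewrite -scalerA.
  by rewrite -scaler_sumr e scalerA mulVf ?scale1r // gt_eqF.
Qed.

(** Colourful Caratheodory in the other [d] colours puts the opposite of the vector at [(i, k)] in a
    transversal cone; adding that vector gives a nonnegative dependence, which general position
    makes strictly positive. *)
Lemma colourful_vertex_covered i k :
  gen_pos (all_pts S p) -> (forall j, in_int_conv (S j) p) ->
  exists2 c : {ffun 'I_d.+1 -> 'I_d.+1}, pos_dep centred (verts c) & c i = k.
Proof.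
move=> hgen hint; have gp A := @gen_pos_indep A hgen.
have cJ : #|[set~ i]| = d by rewrite cardsC1 card_ord.
have [|H [/andP[HJ /imset_injP Hinj] [e e0 aE]]] := @colourful_cone _ _ _ centred _ fst _ cJ gp (- centred (i, k)).
  move=> j _; have [c c0 ->] := int_conv_cone (- centred (i, k)) (hint j).
  exists (fun x => c x.2) => //.
  have -> : [set x : 'I_d.+1 * 'I_d.+1 | x.1 == j] = [set (j, l) | l : 'I_d.+1].
    apply/setP => -[j' l]; rewrite inE /=; apply/eqP/imsetP => [->|[? _ []]//].
    by exists l.
  by rewrite /comb big_imset //= => ? ? _ _ [].
have Hi l : (i, l) \notin H.
  apply/negP => /(imset_f fst)/(subsetP HJ); by rewrite !inE eqxx.
(* Colours other than [i] missed by [H] are filled arbitrarily with [k] and get coefficient zero in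
   [lam]. *)
have /fin_all_exists[c0 c0P] j : exists l, (j = i -> l = k) /\ forall l', (j, l') \in H -> l' = l.
  have [->|ji] := eqVneq j i.
    by exists k; split=> // l'; rewrite (negbTE (Hi l')).
  have [[l lH]|no] := pselect (exists l, (j, l) \in H).
    exists l; split=> [/eqP|l' l'H]; first by rewrite (negbTE ji).
    by have [] := Hinj _ _ l'H lH erefl.
  exists k; split=> // l' l'H; case: no; by exists l'.
pose c := [ffun j => c0 j].
have ci : c i = k by rewrite ffunE; have [-> ] := c0P i.
exists c => //.
have Hc : H \subset verts c.
  by apply/subsetP => -[j l] lH; rewrite mem_verts ffunE; have [_ /(_ _ lH) ->] := c0P j.
have ikc : (i, k) \in verts c by rewrite mem_verts ci.
pose lam x := if x == (i, k) then 1 else if x \in H then e x else 0.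
apply: (@nonneg_pos_dep _ _ _ _ gp _ lam (i, k)) => //.
- by rewrite card_verts card_ord.
- by rewrite /lam eqxx oner_eq0.
- by move=> y _; rewrite /lam; case: eqP => [//|_]; case: ifP => // /e0.
rewrite (comb_D1 _ _ ikc) {1}/lam eqxx scale1r.
suff -> : comb centred (verts c :\ (i, k)) lam = comb centred H e by rewrite -aE subrr.
rewrite /comb (big_setID H) /= [X in _ + X]big1 ?addr0 => [|x]; last first.
  rewrite !inE /lam => /andP[/negbTE xH /andP[/negbTE xik _]].
  by rewrite xik xH scale0r.
apply: eq_big => [x|x]; rewrite !inE.
  case xH: (x \in H); rewrite ?andbF // andbT (subsetP Hc) // andbT.
  by apply: contraTneq xH => ->; apply: Hi.
by move=> /andP[/andP[/negbTE xik _] xH]; rewrite /lam xik xH.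
Qed.
End ColourfulDepth.

Theorem theorem1 (R : realFieldType) (d : nat) (hd : (1 <= d)%N)
    (S : 'I_d.+1 -> 'I_d.+1 -> 'rV[R]_d) (p : 'rV[R]_d)
    (hgen : gen_pos (all_pts S p))
    (hint : forall i : 'I_d.+1, in_int_conv (S i) p) :
  exists C : {set {ffun 'I_d.+1 -> 'I_d.+1}},
    (((d.+1 ^ 2).+1 %/ 2)%N <= #|C|)%N /\
    forall c, c \in C -> colourful_contains S p c.
Proof.
have gp A := gen_pos_indep (A := A) hgen.
pose f B := `[< pos_dep (centred S p) B >].
exists [set c | f (verts c)]; split=> [|c]; last first.
  by rewrite inE => /asboolP; apply: pos_dep_colourful_contains.
have oct : octahedral [set c | f (verts c)].
  apply: (cocycle_octahedral ord0) => F; rewrite card_ord; exact: pos_dep_cocycle.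
have := octahedral_card (leqnn _) oct; rewrite card_ord => h.
(* The target is the ceiling of half of [d.+1 ^ 2], so by integrality it is enough to bound twice
   the cardinal. *)
suff : (d.+1 ^ 2 <= 2 * #|[set c | f (verts c)]|)%N.
  by move: (d.+1 ^ 2)%N #|_| => m k; lia.
apply: h => i k; have [c cP ci] := colourful_vertex_covered i k hgen hint.
by exists c => //; rewrite inE; apply/asboolP.
Qed.
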